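(* Let $(\mathfrak{g},\mathfrak{k})$ be $(\mathfrak{gl}(n,\mathbb{C}),\mathfrak{gl}(n-1,\mathbb{C}))$ or $(\mathfrak{so}(n,\mathbb{C}),\mathfrak{so}(n-1,\mathbb{C}))$, and let $x\in\mathfrak{g}(0)=\{x\in\mathfrak{g}:\sigma(x_{\mathfrak{k}})\cap\sigma(x)=\emptyset\}$. Then $x$ is $n$-strongly regular.
   Context: Let $n\ge 2$. For $\mathfrak{g}=\mathfrak{gl}(n,\mathbb{C})$, $\mathfrak{k}=\mathfrak{gl}(n-1,\mathbb{C})$ is the upper left $(n-1)\times(n-1)$ corner, $x_{\mathfrak{k}}$ is the upper left $(n-1)\times(n-1)$ submatrix of $x$, and $\sigma(x)$, $\sigma(x_{\mathfrak{k}})$ are the sets of eigenvalues of the $n\times n$ matrix $x$ and of the $(n-1)\times(n-1)$ matrix $x_{\mathfrak{k}}$. For $\mathfrak{g}=\mathfrak{so}(n,\mathbb{C})$ (for a nondegenerate symmetric bilinear form on $\mathbb{C}^n$), $\mathfrak{k}=\mathfrak{so}(n-1,\mathbb{C})$ is the annihilator in $\mathfrak{g}$ of a fixed non-isotropic vector, equivalently the fixed points of the involution $\theta$ given by conjugation by the orthogonal reflection in that vector; $x_{\mathfrak{k}}$ is the projection of $x$ onto $\mathfrak{k}$ along the $-1$-eigenspace of $\theta$, regarded as an element of $\mathfrak{so}(n-1,\mathbb{C})$. For $y\in\mathfrak{so}(m,\mathbb{C})$, the spectrum $\sigma(y)$ is the multiset of eigenvalues of $y$, except that if $m$ is odd one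 occurrence of the eigenvalue $0$ is omitted (so if $0$ has multiplicity $2j+1$ it is listed $2j$ times). An element $x\in\mathfrak{g}$ is $n$-strongly regular if $\mathfrak{z}_{\mathfrak{k}}(x_{\mathfrak{k}})\cap\mathfrak{z}_{\mathfrak{g}}(x)=0$, where $\mathfrak{z}$ denotes the centralizer. *)

(* Defs.v *)
From mathcomp Require Import all_boot all_order all_algebra.
From mathcomp Require Import finmap multiset.
From mathcomp Require Import boolp classical_sets reals complex.

Set Implicit Arguments.
Unset Strict Implicit.
Unset Printing Implicit Defensive.

Import Order.TTheory GRing.Theory Num.Theory.

Local Open Scope ring_scope.
Local Open Scope complex_scope.
Local Open Scope classical_set_scope.

(* The complex numbers are R[i] for R : realType.  As everywhere in MathComp,
   matrices act on row vectors on the right, u |-> u *m x; the eigenvalue,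
   kermx and restrictmx of the library all refer to this action.  *)

Section Centralizers.
Variables (R : realType) (n : nat).
Implicit Types (g k : set 'M[R[i]]_n) (x xk : 'M[R[i]]_n).

Definition centralizer g x : set 'M[R[i]]_n :=
  [set z | g z /\ z *m x = x *m z].

(* xk is the component x_k of x, seen in g via the inclusion of k in g *)
Definition strongly_regular g k xk x : Prop :=
  centralizer k xk `&` centralizer g x = [set 0].

End Centralizers.

Section GL.
Variables (R : realType) (n : nat).

Definition gl : set 'M[R[i]]_n := setT.

(* gl(n-1), embedded in gl(n) as the upper left corner *)
Definition gl_k : set 'M[R[i]]_n :=
  [set z | forall i j : 'I_n, i = n.-1 :> nat \/ j = n.-1 :> nat -> z i j = 0].

Definition gl_corner (x : 'M[R[i]]_n) : 'M[R[i]]_n.-1 :=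
  mxsub (widen_ord (leq_pred n)) (widen_ord (leq_pred n)) x.

(* gl_corner x, as an element of gl_k *)
Definition gl_proj (x : 'M[R[i]]_n) : 'M[R[i]]_n :=
  \matrix_(i, j) if (i < n.-1)%N && (j < n.-1)%N then x i j else 0.

Definition gl_zero : set 'M[R[i]]_n :=
  [set x | gl x /\
     [set a | eigenvalue (gl_corner x) a] `&` [set a | eigenvalue x a] = set0].

End GL.

Section SO.
Variable R : realType.

Definition eigenvalue_mset (m : nat) (y : 'M[R[i]]_m) : {mset R[i]}%mset :=
  seq_mset (sval (closed_field_poly_normal (char_poly y))).

(* For m odd, 0 is an eigenvalue of every y in so(m); one occurrence of it is
   dropped.  [`\] is multiset difference, lowering the multiplicity by one. *)
Definition so_spectrum (m : nat) (y : 'M[R[i]]_m) : {mset R[i]}%mset :=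
  if odd m then (eigenvalue_mset y `\ 0)%mset else eigenvalue_mset y.

Variable n : nat.
(* B is the Gram matrix of the form (u, w) |-> u *m B *m w^T *)
Variables (B : 'M[R[i]]_n) (v : 'rV[R[i]]_n).

Definition so : set 'M[R[i]]_n := [set x | x *m B + B *m x^T = 0].

Definition so_k : set 'M[R[i]]_n := [set x | so x /\ v *m x = 0].

(* u |-> u - 2 (u, v) / (v, v) v *)
Definition reflection : 'M[R[i]]_n :=
  1%:M - (2 / (v *m B *m v^T) 0 0) *: (B *m v^T *m v).

Definition theta (x : 'M[R[i]]_n) : 'M[R[i]]_n :=
  reflection *m x *m invmx reflection.

(* the +1-component of x for theta, i.e. its projection onto so_k along the
   -1-eigenspace: see so_proj_k and so_proj_opp *)
Definition so_proj (x : 'M[R[i]]_n) : 'M[R[i]]_n := 2^-1 *: (x + theta x).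

(* the rows span the orthogonal of v *)
Definition perp : 'M[R[i]]_n := kermx (B *m v^T).

(* so_proj x acting on the orthogonal of v, whose dimension \rank perp is n-1
   (rank_perp); this is x_k as an element of so(n-1) *)
Definition so_restr (x : 'M[R[i]]_n) : 'M[R[i]]_(\rank perp) :=
  restrictmx perp (so_proj x).

Definition so_zero : set 'M[R[i]]_n :=
  [set x | so x /\
     (so_spectrum (so_restr x) `&` so_spectrum x)%mset = mset0].

Hypotheses (symB : B^T = B) (anisov : (v *m B *m v^T) 0 0 != 0).

Lemma rank_perp : \rank perp = n.-1.
Proof.
rewrite mxrank_ker; set w := B *m v^T.
suff -> : \rank w = 1%N by rewrite subn1.
apply/eqP; rewrite eqn_leq rank_leq_col lt0n mxrank_eq0.
apply: contraNneq anisov => w0.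
by rewrite -mulmxA -/w w0 mulmx0 mxE.
Qed.

Lemma reflectionK : reflection *m reflection = 1%:M.
Proof.
rewrite /reflection; set q := (_ 0 0); set P := B *m v^T *m v.
have PP : P *m P = q *: P.
  rewrite /P -[LHS]mulmxA [X in _ *m X]mulmxA [X in _ *m (X *m _)]mulmxA.
  by rewrite [v *m B *m v^T]mx11_scalar -/q mul_scalar_mx -scalemxAr.
rewrite mulmxBl mul1mx mulmxBr mulmx1 -scalemxAl -scalemxAr PP !scalerA.
have -> : 2 / q * (2 / q) * q = 2 / q + 2 / q.
  by rewrite -mulrA divfK // mulr_natr mulr2n.
by rewrite opprB scalerDl addrK subrK.
Qed.

Lemma theta_reflection x : theta x = reflection *m x *m reflection.
Proof.
rewrite /theta; congr (_ *m _).
have [U _] := mulmx1_unit reflectionK.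
by rewrite -[LHS]mulmx1 -reflectionK mulmxA mulVmx // mul1mx.
Qed.

Lemma thetaK x : theta (theta x) = x.
Proof.
rewrite !theta_reflection !mulmxA reflectionK mul1mx.
by rewrite -mulmxA reflectionK mulmx1.
Qed.

Lemma theta_is_linear a x y : theta (a *: x + y) = a *: theta x + theta y.
Proof. by rewrite /theta mulmxDr mulmxDl -scalemxAr -scalemxAl. Qed.

Lemma so_proj_opp x : theta (x - so_proj x) = - (x - so_proj x).
Proof.
have thN y : theta (- y) = - theta y by rewrite /theta mulmxN mulNmx.
have -> : x - so_proj x = 2^-1 *: (x - theta x).
  have half : 1 = 2^-1 + 2^-1 :> R[i].
    by rewrite -[RHS]mulr2n -[RHS]mulr_natr mulVf // pnatr_eq0.
  rewrite /so_proj scalerDr [in RHS]scalerBr -{1}[x]scale1r {1}half scalerDl.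
  by rewrite opprD addrA addrK.
rewrite -[2^-1 *: _]addr0 theta_is_linear.
have -> : theta 0 = 0 by rewrite /theta mulmx0 mul0mx.
rewrite !addr0 -scalerN opprB; congr (_ *: _).
by rewrite -[x - _]addrC -[- theta x]scaleN1r theta_is_linear thetaK
  scaleN1r addrC.
Qed.

Lemma so_proj_k x : so x -> so_k (so_proj x).
Proof.
rewrite /so_k /so /= => sox.
have Bt : B *m reflection^T = reflection *m B.
  rewrite /reflection linearB /= linearZ /= trmx1 mulmxBr mulmxBl mulmx1 mul1mx.
  congr (_ - _); rewrite -scalemxAr -scalemxAl; congr (_ *: _).
  by rewrite !trmx_mul trmxK symB !mulmxA.
have vr : v *m reflection = - v.
  rewrite /reflection; set q := (_ 0 0).
  rewrite mulmxBr mulmx1 -scalemxAr !mulmxA.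
  rewrite [v *m B *m v^T]mx11_scalar -/q mul_scalar_mx scalerA divfK //.
  by rewrite scaler_nat mulr2n opprD addrA subrr add0r.
have Bx : B *m x^T = - (x *m B) by apply/eqP; rewrite -addr_eq0 addrC sox.
have vv : v *m x *m B *m v^T = 0.
  set s := LHS; have sT : s^T = - s.
    by rewrite /s !trmx_mul trmxK symB !mulmxA -[v *m B *m _]mulmxA Bx
       mulmxN mulNmx !mulmxA.
  have : s *+ 2 = 0.
    have -> : s *+ 2 = s - s^T by rewrite sT opprK.
    by rewrite [s]mx11_scalar tr_scalar_mx subrr.
  by move/eqP; rewrite -scaler_nat scaler_eq0 pnatr_eq0 /= => /eqP.
split.
  rewrite /so_proj theta_reflection [(_ *: _)^T]linearZ /=.
  rewrite [(_ + _)^T]linearD /= !trmx_mul -scalemxAl -scalemxAr -scalerDr.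
  rewrite mulmxDl [B *m (_ + _)]mulmxDr addrACA sox add0r.
  rewrite !mulmxA Bt -[reflection *m B *m _]mulmxA Bx mulmxN mulNmx.
  by rewrite mulmxA -[_ *m B *m _]mulmxA Bt !mulmxA subrr scaler0.
have vxr : v *m x *m reflection = v *m x.
  rewrite /reflection mulmxBr mulmx1 -scalemxAr !mulmxA vv mul0mx scaler0.
  by rewrite subr0.
rewrite /so_proj theta_reflection -scalemxAr mulmxDr !mulmxA vr !mulNmx vxr.
by rewrite subrr scaler0.
Qed.

End SO.

(* Main.v *)
(* Let y <> 0 centralize x_k in k and x in g.  The row space W of y is stable
   under x, and x and x_k agree on W, so an eigenvector of x in W gives x and x_k
   a common eigenvalue a.  For gl this contradicts the hypothesis.  For so, one
   occurrence of 0 is dropped in odd dimension, so when a = 0 one needs 0 to be a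
   multiple root of both characteristic polynomials.  This holds because the
   eigenvector is in the image of a skew matrix commuting with x (resp. x_k),
   which makes it orthogonal to some nonzero vector of the kernel. *)
Require Import Defs.
From mathcomp Require Import all_boot all_order all_algebra.
From mathcomp Require Import finmap multiset.
From mathcomp Require Import boolp classical_sets reals complex.

Set Implicit Arguments.
Unset Strict Implicit.
Unset Printing Implicit Defensive.

Import Order.TTheory GRing.Theory Num.Theory.

Local Open Scope ring_scope.
Local Open Scope complex_scope.

(** * Double roots at 0, and eigenvectors in the image of a commuting matrix *)

Lemma unitmx_with_row (F : fieldType) (m : nat) (i : 'I_m) (w : 'rV[F]_m) :
  w != 0 -> exists2 g : 'M[F]_m, g \in unitmx & row i g = w.
Proof.
move=> w_neq0; pose e : 'rV[F]_m := delta_mx 0 i.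
have ew : e *m (delta_mx i 0 *m w) = w.
  by rewrite mulmxA mul_delta_mx [delta_mx _ _]mx11_scalar mxE !eqxx mul1mx.
(* The rank-one map sending [e] to [w] is injective on the line of [e], so it agrees there with an
   invertible matrix. *)
have [|g g_unit] := @complete_unitmx _ _ _ e (delta_mx i 0 *m w).
  by rewrite ew mxrank_delta rank_rV w_neq0.
by rewrite ew => ->; exists g; rewrite // rowE.
Qed.

(* In bases whose i-th vectors are w and z, the i-th row and the i-th column of
   X - A are both divisible by X, and the entry where they cross vanishes. *)
Lemma dvdp_X2_char_poly (F : fieldType) (m : nat) (A : 'M[F]_m)
    (w : 'rV[F]_m) (z : 'cV[F]_m) :
  w != 0 -> z != 0 -> w *m A = 0 -> A *m z = 0 -> w *m z = 0 ->
  'X^2 %| char_poly A.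
Proof.
move=> w_neq0 z_neq0 wA Az wz.
(* Any index will do; [w] only serves to show that there is one. *)
have [i _] : exists i, w 0 i != 0 by apply/rV0Pn.
have [E uE rE] := unitmx_with_row i w_neq0.
have zT_neq0 : z^T != 0 by rewrite trmx_eq0.
have [G uG rG] := unitmx_with_row i zT_neq0.
have cG : col i G^T = z by rewrite -tr_row rG trmxK.
have EA j : (E *m A *m G^T) i j = 0.
  have -> : (E *m A *m G^T) i j = row i (E *m A *m G^T) 0 j by rewrite !mxE.
  by rewrite !row_mul rE wA mul0mx mxE.
have AG j : (E *m A *m G^T) j i = 0.
  have -> : (E *m A *m G^T) j i = col i (E *m A *m G^T) j 0 by rewrite !mxE.
  by rewrite -mulmxA !colE -!mulmxA -colE cG Az mulmx0 mxE.
have EG : (E *m G^T) i i = 0.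
  have -> : (E *m G^T) i i = (row i E *m col i G^T) 0 0.
    by rewrite !mxE; apply: eq_bigr => k _; rewrite !mxE.
  by rewrite rE cG wz mxE.
pose P := map_mx polyC E *m char_poly_mx A *m map_mx polyC G^T.
have PE j k : P j k = 'X * ((E *m G^T) j k)%:P - ((E *m A *m G^T) j k)%:P.
  rewrite /P /char_poly_mx mulmxBr mulmxBl mul_mx_scalar -scalemxAl.
  by rewrite -!map_mxM !mxE.
have detP : \det P = (\det E)%:P * char_poly A * (\det G)%:P.
  by rewrite /P !det_mulmx !det_map_mx det_tr.
clearbody P.
(* Off the crossing, row [i] and column [i] of [P] are ['X] times the constants kept in [P']. At the
   crossing ['X] is taken out twice, which is harmless as both sides are 0 there by [EG]. *)
pose d : 'rV[{poly F}]_m := \row_j if j == i then 'X else 1.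
pose P' : 'M[{poly F}]_m :=
  \matrix_(j, k) if (j == i) || (k == i) then ((E *m G^T) j k)%:P else P j k.
have PdP : P = diag_mx d *m P' *m diag_mx d.
  apply/matrixP => j k; rewrite mul_diag_mx mul_mx_diag.
  rewrite 2!mxE [P' _ _]mxE [d _ j]mxE [d _ k]mxE PE.
  case: (eqVneq j i) => [->|_]; case: (eqVneq k i) => [->|_] /=.
  all: rewrite ?EG ?EA ?AG ?polyC0 ?mulr0 ?mul0r ?subr0 ?mulr1 ?mul1r //.
  by rewrite mulrC.
have dd : \det (diag_mx d) = 'X.
  rewrite det_diag (bigD1 i) //= mxE eqxx big1 ?mulr1 // => j /negPf ji.
  by rewrite mxE ji.
have : 'X^2 %| \det P.
  by rewrite PdP !det_mulmx dd mulrAC -expr2 dvdp_mulr.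
rewrite detP mul_polyC -[_ * _%:P]mulrC mul_polyC.
by rewrite !dvdpZr // -?unitfE -?unitmxE.
Qed.

(** Commutation makes the row space of [y] stable under [x]; it is nonzero, so over an algebraically
    closed field the restriction of [x] to it has an eigenvector. *)
Lemma eigenvector_in_image (C : numClosedFieldType) (n : nat)
    (x y : 'M[C]_n) :
  y != 0 -> y *m x = x *m y ->
  exists (a : C) (u : 'rV_n), u *m y != 0 /\ u *m y *m x = a *: (u *m y).
Proof.
move=> y_neq0 yx.
have stab : stablemx (row_base y) x.
  by rewrite stablemx_row_base yx submxMl.
have [|a /eigenvalueP[w wx w_neq0]] := @eigenvalue_closed _ _ (restrictmx y x).
  by rewrite lt0n mxrank_eq0.
have /submxP[u wu] : (w *m row_base y <= y)%MS.
  by rewrite (submx_trans (submxMl _ _)) // eq_row_base.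
exists a, u; rewrite -wu; split.
  by rewrite mulmx_free_eq0 ?row_base_free.
have rbx : restrictmx y x *m row_base y = row_base y *m x by exact: mulmxKpV.
by rewrite -mulmxA -rbx mulmxA wx scalemxAl.
Qed.

(** * Spectra of matrices that are skew for a symmetric form *)

Lemma skew_isotropic (F : numFieldType) (n : nat) (B x : 'M[F]_n)
    (w : 'rV[F]_n) :
  B^T = B -> x *m B + B *m x^T = 0 -> w *m x *m B *m w^T = 0.
Proof.
move=> symB /eqP; rewrite addr_eq0 => /eqP xB.
(* A 1 x 1 matrix is its own transpose, whereas skewness changes the sign. *)
set s := LHS; have sT : s^T = - s.
  rewrite /s !trmx_mul trmxK symB -[w *m x *m B]mulmxA xB.
  by rewrite mulmxN mulNmx opprK !mulmxA.
have : s *+ 2 = 0.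
  have -> : s *+ 2 = s - s^T by rewrite sT opprK.
  by rewrite [s]mx11_scalar tr_scalar_mx subrr.
by move/eqP; rewrite -scaler_nat scaler_eq0 pnatr_eq0 /= => /eqP.
Qed.

(* The witness z is B t^T with t := w y, or t := w if w y = 0: either way t is a
   nonzero vector of the kernel of x orthogonal to w. *)
Lemma skew_dvdp_X2_char_poly (F : numFieldType) (n : nat) (B x y : 'M[F]_n)
    (u : 'rV[F]_n) :
  B^T = B -> B \in unitmx ->
  x *m B + B *m x^T = 0 -> y *m B + B *m y^T = 0 -> y *m x = x *m y ->
  u *m y != 0 -> u *m y *m x = 0 -> 'X^2 %| char_poly x.
Proof.
move=> symB uB skx sky yx; set w := u *m y => w_neq0 wx.
have [t [t_neq0 tx wt]] : exists t : 'rV_n,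
    [/\ t != 0, t *m x = 0 & w *m B *m t^T = 0].
  have [wy0|wy_neq0] := eqVneq (w *m y) 0.
    exists w; split=> //; rewrite {1}/w -[u *m y *m B]mulmxA.
    move/eqP: sky; rewrite addr_eq0 => /eqP ->.
    by rewrite mulmxN mulNmx -!mulmxA -trmx_mul wy0 trmx0 !mulmx0 oppr0.
  exists (w *m y); split=> //; first by rewrite -mulmxA yx mulmxA wx mul0mx.
  clearbody w; apply: trmx_inj.
  by rewrite !trmx_mul !trmxK symB trmx0 !mulmxA skew_isotropic.
apply: (@dvdp_X2_char_poly _ _ _ w (B *m t^T)) => //.
- apply: contra_neq t_neq0 => /(congr1 (mulmx (invmx B))).
  by rewrite mulKmx // mulmx0 => /(congr1 trmx); rewrite trmxK trmx0.
- move/eqP: skx; rewrite addr_eq0 mulmxA => /eqP ->.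
  by rewrite mulNmx -mulmxA -trmx_mul tx trmx0 mulmx0 oppr0.
- by rewrite mulmxA.
Qed.

Lemma eigenvalue_msetE (R : realType) (m : nat) (y : 'M[R[i]]_m) (a : R[i]) :
  eigenvalue_mset y a = mup a (char_poly y).
Proof.
rewrite /eigenvalue_mset; case: closed_field_poly_normal => s /= sE.
rewrite mset_seqE -mu_prod_XsubC.
by rewrite [in RHS]sE (monicP (char_poly_monic y)) scale1r.
Qed.

Lemma skew_eigenvalue_so_spectrum (R : realType) (m : nat)
    (B x y : 'M[R[i]]_m) (u : 'rV[R[i]]_m) (a : R[i]) :
  B^T = B -> B \in unitmx ->
  x *m B + B *m x^T = 0 -> y *m B + B *m y^T = 0 -> y *m x = x *m y ->
  u *m y != 0 -> u *m y *m x = a *: (u *m y) -> (0 < so_spectrum x a)%N.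
Proof.
move=> symB uB skx sky yx w_neq0 wx.
have chi_neq0 := monic_neq0 (char_poly_monic x).
have mult1 : (0 < mup a (char_poly x))%N.
  rewrite mup_geq // dvdp_XsubCl -eigenvalue_root_char.
  by apply/eigenvalueP; exists (u *m y).
rewrite /so_spectrum; case: ifP => _; rewrite ?msetB1E eigenvalue_msetE //.
(* Only odd [m] remains: dropping one 0 leaves nonzero [a] untouched, while [a = 0] must be a double
   root. *)
have [a0|_] := eqVneq a 0; last by rewrite subn0.
rewrite subn_gt0 mup_geq // a0 subr0.
by apply: skew_dvdp_X2_char_poly w_neq0 _; eauto; rewrite wx a0 scale0r.
Qed.

(** * The general linear pair *)

Lemma gl_strongly_regular (R : realType) (n : nat) (x : 'M[R[i]]_n) :
  gl_zero x -> strongly_regular (@gl R n) (@gl_k R n) (gl_proj x) x.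
Proof.
case=> _ disj; apply/seteqP; split=> [y /= [[ky _] [_ yx]]|_ ->]; last first.
  by rewrite /centralizer /gl /gl_k /=; split; rewrite ?mul0mx ?mulmx0;
    do ?split => // i j _; rewrite mxE.
apply: contrapT => /eqP y_neq0.
have [a [u [w_neq0 wx]]] := eigenvector_in_image y_neq0 yx.
set w := u *m y in w_neq0 wx.
(* The last column of [y] is zero, hence so is the last coordinate of every vector in its row space.
   Truncating [w] then gives an eigenvector of the corner. *)
have w_last (i : 'I_n) : i = n.-1 :> nat -> w 0 i = 0.
  by move=> i_last; rewrite mxE big1 // => j _; rewrite ky ?mulr0 //; right.
clearbody w; case: n => [|n] in x y u w disj ky yx w_neq0 wx w_last y_neq0 *.
  by rewrite [w]thinmx0 eqxx in w_neq0.
suff : [set a | eigenvalue (gl_corner x) a]%classic a /\ eigenvalue x a.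
  by rewrite -[False]/((set0 : set R[i])%classic a) -disj.
split; last by apply/eigenvalueP; exists w.
pose f := widen_ord (leq_pred n.+1).
have f_lt (j : 'I_n.+1) : j != ord_max -> exists j', j = f j'.
  move=> jmax; have jn : (j < n)%N.
    by rewrite ltn_neqAle -ltnS ltn_ord andbT.
  by exists (Ordinal jn); apply: val_inj.
apply/eigenvalueP; exists (colsub f w).
  apply/rowP => j; have := congr1 (fun v : 'rV_n.+1 => v 0 (f j)) wx.
  rewrite !mxE big_ord_recr /= (w_last ord_max) // mul0r addr0 => <-.
  by apply: eq_bigr => k _; rewrite !mxE; congr (w 0 _ * x _ _); apply: val_inj.
apply: contra_neq w_neq0 => /rowP w0; apply/rowP => j; rewrite [RHS]mxE.
have [->|/f_lt [j' ->]] := eqVneq j ord_max; first exact: w_last.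
by have := w0 j'; rewrite !mxE.
Qed.

(** * The orthogonal pair: passage to the orthogonal of [v] *)

Lemma so_mul_normal (R : realType) (n : nat) (B y : 'M[R[i]]_n)
    (v : 'rV[R[i]]_n) :
  so_k B v y -> y *m B *m v^T = 0.
Proof.
case=> /eqP; rewrite addr_eq0 => /eqP -> vy.
by rewrite mulNmx -mulmxA -trmx_mul vy trmx0 mulmx0 oppr0.
Qed.

(* y absorbs the reflection r on both sides while r anticommutes with
   p := x - so_proj B v x, so y p = y r p = - y p r = - p y r = - p y. *)
Lemma so_centralizer_proj (R : realType) (n : nat) (B x y : 'M[R[i]]_n)
    (v : 'rV[R[i]]_n) :
  B^T = B -> (v *m B *m v^T) 0 0 != 0 -> so_k B v y ->
  y *m x = x *m y -> y *m so_proj B v x = so_proj B v x *m y ->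
  y *m so_proj B v x = y *m x.
Proof.
move=> symB anisov ky yx yxk.
set p := x - so_proj B v x; set r := reflection B v.
have yp : y *m p = p *m y by rewrite mulmxBr mulmxBl yx yxk.
have yr : y *m r = y.
  rewrite mulmxBr mulmx1 -scalemxAr !mulmxA so_mul_normal //.
  by rewrite mul0mx scaler0 subr0.
have rp : r *m p = - (p *m r).
  have := so_proj_opp anisov x; rewrite theta_reflection // -/p -/r => rpr.
  by rewrite -mulNmx -rpr -[RHS]mulmxA reflectionK // mulmx1.
have ypN : y *m p = - (y *m p).
  by rewrite -{1}yr -mulmxA rp mulmxN mulmxA yp -mulmxA yr.
apply/eqP; rewrite eq_sym -subr_eq0 -mulmxBr -/p.
have /eqP := ypN; rewrite -addr_eq0 -mulr2n -scaler_nat scaler_eq0.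
by rewrite pnatr_eq0.
Qed.

(** The right-hand side is the orthogonal projection along [v]. Its image lies in [perp B v], and
    [K] gives the coordinates of projected vectors in the chosen basis. *)
Lemma perp_projection (R : realType) (n : nat) (B : 'M[R[i]]_n)
    (v : 'rV[R[i]]_n) :
  (v *m B *m v^T) 0 0 != 0 ->
  exists K, K *m row_base (perp B v) =
    1%:M - ((v *m B *m v^T) 0 0)^-1 *: (B *m v^T *m v).
Proof.
set q := (_ 0 0) => anisov; set Q := 1%:M - _.
suff /submxP[K ->] : (Q <= row_base (perp B v))%MS by exists K.
rewrite eq_row_base; apply/sub_kermxP.
rewrite mulmxBl mul1mx -scalemxAl -[_ *m v *m _]mulmxA [v *m _]mulmxA.
rewrite [v *m B *m v^T]mx11_scalar -/q mul_mx_scalar scalerA mulVf //.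
by rewrite scale1r subrr.
Qed.

(** A vector of [perp B v] orthogonal to all of [perp B v] is also orthogonal to [v], hence to the
    whole space, and nondegeneracy of [B] makes it zero. *)
Lemma perp_gram_unitmx (R : realType) (n : nat) (B : 'M[R[i]]_n)
    (v : 'rV[R[i]]_n) :
  B \in unitmx -> (v *m B *m v^T) 0 0 != 0 ->
  row_base (perp B v) *m B *m (row_base (perp B v))^T \in unitmx.
Proof.
move=> uB anisov; have [K KbE] := perp_projection anisov.
have b_perp : (row_base (perp B v) <= perp B v)%MS by rewrite eq_row_base.
have free_b : row_free (row_base (perp B v)) by exact: row_base_free.
move: (row_base _) K KbE b_perp free_b => b K KbE b_perp free_b.
rewrite -row_free_unit; apply: inj_row_free => s.
rewrite !mulmxA => sBb.
have sBv : s *m b *m B *m v^T = 0.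
  by rewrite -mulmxA; apply/sub_kermxP; apply: submx_trans (submxMl _ _) b_perp.
have : s *m b *m B *m (K *m b)^T = 0 by rewrite trmx_mul mulmxA sBb mul0mx.
rewrite KbE linearB linearZ /= trmx1 mulmxBr mulmx1 -scalemxAr !trmx_mul trmxK.
rewrite !mulmxA sBv !mul0mx scaler0 subr0 => sB.
by apply: (row_free_inj free_b); rewrite mul0mx -[LHS](mulmxK uB) sB mul0mx.
Qed.

Lemma so_restrict (R : realType) (n : nat) (B y : 'M[R[i]]_n)
    (v : 'rV[R[i]]_n) :
  so_k B v y ->
  restrictmx (perp B v) y *m row_base (perp B v) = row_base (perp B v) *m y.
Proof.
move=> ky; apply: mulmxKpV; rewrite stablemx_row_base; apply/sub_kermxP.
by rewrite -mulmxA [y *m _]mulmxA so_mul_normal // mulmx0.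
Qed.

(** This makes the spectral lemma for skew matrices available on [perp B v], with the Gram matrix of
    the restricted form. *)
Lemma so_restrict_skew (R : realType) (n : nat) (B y : 'M[R[i]]_n)
    (v : 'rV[R[i]]_n) (b := row_base (perp B v)) :
  so_k B v y ->
  restrictmx (perp B v) y *m (b *m B *m b^T)
    + b *m B *m b^T *m (restrictmx (perp B v) y)^T = 0.
Proof.
move=> ky; have [/= sky _] := ky.
have : restrictmx (perp B v) y *m b = b *m y := so_restrict ky.
move: (restrictmx _ y); clearbody b => Y Yb.
rewrite -[_ *m b^T *m _]mulmxA -trmx_mul !mulmxA Yb trmx_mul !mulmxA -mulmxDl.
by rewrite -[b *m y *m B]mulmxA -[b *m B *m _]mulmxA -mulmxDr sky mulmx0 mul0mx.
Qed.

Lemma so_strongly_regular (R : realType) (n : nat) (B x : 'M[R[i]]_n)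
    (v : 'rV[R[i]]_n) :
  B^T = B -> B \in unitmx -> (v *m B *m v^T) 0 0 != 0 -> so_zero B v x ->
  strongly_regular (so B) (so_k B v) (so_proj B v x) x.
Proof.
move=> symB uB anisov [sox disj].
apply/seteqP; split=> [y /= [[ky yxk] [soy yx]]|_ ->]; last first.
  by rewrite /centralizer /so_k /so /=; do ?split;
    rewrite ?trmx0 ?mul0mx ?mulmx0 ?addr0.
apply: contrapT => /eqP y_neq0.
have [a [u [w_neq0 wx]]] := eigenvector_in_image y_neq0 yx.
set w := u *m y in w_neq0 wx.
have kxk := so_proj_k symB anisov sox; set xk := so_proj B v x in yxk kxk.
have wxk : w *m xk = a *: w.
  by rewrite -wx /w -!mulmxA (so_centralizer_proj symB anisov ky yx yxk).
have [K KbE] := perp_projection anisov.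
have free_b : row_free (row_base (perp B v)) by exact: row_base_free.
have gram_unit := perp_gram_unitmx uB anisov.
have skewY := so_restrict_skew ky; have skewX := so_restrict_skew kxk.
have Yb := so_restrict ky; have Xb := so_restrict kxk.
rewrite -/(so_restr B v x) in skewX Xb.
move: K KbE free_b gram_unit skewY skewX Yb Xb.
move: (restrictmx _ y); move: (row_base _).
move=> b Y K KbE free_b gram_unit skewY skewX Yb Xb.
(* Since [y] kills [v], replacing [u] by its projection does not change [u *m y]. So [w], in
   coordinates, lies in the image of the restriction [Y] of [y]. *)
have wE : u *m K *m Y *m b = w.
  rewrite -mulmxA Yb -mulmxA [K *m _]mulmxA KbE mulmxBl mul1mx -scalemxAl.
  by rewrite -[_ *m v *m y]mulmxA ky.2 mulmx0 scaler0 subr0.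
have mult_x : (0 < so_spectrum x a)%N.
  exact: (skew_eigenvalue_so_spectrum symB uB sox soy yx w_neq0 wx).
have mult_xk : (0 < so_spectrum (so_restr B v x) a)%N.
  apply: (@skew_eigenvalue_so_spectrum _ _ (b *m B *m b^T) _ Y (u *m K)) => //.
  - by rewrite !trmx_mul trmxK symB mulmxA.
  (* Identities on [perp B v] are checked in the ambient space, after multiplying by the free basis
     [b]. *)
  - apply: (row_free_inj free_b); rewrite -[LHS]mulmxA Xb mulmxA Yb.
    by rewrite -[RHS]mulmxA Yb mulmxA Xb -!mulmxA yxk.
  - by rewrite -(mulmx_free_eq0 _ free_b) wE.
  - apply: (row_free_inj free_b).
    by rewrite -[LHS]mulmxA Xb mulmxA wE wxk -scalemxAl wE.
have : (so_spectrum (so_restr B v x) `&` so_spectrum x)%mset a = 0%N.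
  by rewrite disj mset0E.
by rewrite msetE2 => /eqP; rewrite -leqn0 leqNgt leq_min mult_xk mult_x.
Qed.

Theorem theorem4p16 (R : realType) (n : nat) (hn : (2 <= n)%N) :
  (forall x : 'M[R[i]]_n,
     gl_zero x ->
     strongly_regular (@gl R n) (@gl_k R n) (gl_proj x) x) /\
  (forall (B : 'M[R[i]]_n) (v : 'rV[R[i]]_n),
     B^T = B -> B \in unitmx -> (v *m B *m v^T) 0 0 != 0 ->
     forall x : 'M[R[i]]_n,
       so_zero B v x ->
       strongly_regular (so B) (so_k B v) (so_proj B v x) x).
Proof.
split; first exact: gl_strongly_regular.
by move=> B v symB uB anisov x; exact: so_strongly_regular.
Qed.
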